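(* For every $\alpha\in(0,1)$, $$\lim_{r\to\infty}e_{\alpha,r}=\left(\frac1\alpha\right)^{\alpha}\left(\frac1{1-\alpha}\right)^{1-\alpha},$$ where $e_{\alpha,r}=\lim_{n\to\infty}\sqrt[n]{|B_{n,\alpha,r}|}$.
   Context: For a word $w=w_1w_2\dots w_n\in\{0,1\}^n$ and $k\le n$, $w[:k]=w_1\dots w_k$ denotes the prefix of length $k$, and $|u|_0$ denotes the number of letters of the word $u$ equal to $0$. For a natural number $n$, an integer $r\ge1$ and $0\le\alpha\le1$, $$B_{n,\alpha,r}=\{w\in\{0,1\}^n : \text{for all } k\le n,\ \alpha k-r<|w[:k]|_0\le \alpha k+r\}.$$ The limit defining $e_{\alpha,r}$ exists for all $\alpha\in(0,1)$ and all integers $r\ge1$. *)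

(* Defs.v *)
From HB Require Import structures.
From mathcomp Require Import all_boot all_order all_algebra.
From mathcomp Require Import all_classical all_reals all_analysis.

Set Implicit Arguments.
Unset Strict Implicit.
Unset Printing Implicit Defensive.

Import Order.TTheory GRing.Theory Num.Theory.
Import numFieldNormedType.Exports.
Local Open Scope ring_scope.

(* Binary words are sequences of booleans, false being the letter 0. *)
Definition zeros (u : seq bool) : nat := count_mem false u.

Definition balanced_words (R : realType) (n : nat) (alpha : R) (r : nat) :
    {set n.-tuple bool} :=
  [set w : n.-tuple bool | [forall k : 'I_n.+1,
     (alpha * k%:R - r%:R < (zeros (take k w))%:R :> R)
     && ((zeros (take k w))%:R <= alpha * k%:R + r%:R :> R)]].

(* The n-th root is the real power of exponent 1/n; the value at n = 0 does
   not affect the limit. *)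
Definition growth_rate (R : realType) (alpha : R) (r : nat) : R :=
  limn (fun n : nat => #|balanced_words n alpha r|%:R `^ n%:R^-1 : R).

(* Main.v *)
Require Import Defs.
From mathcomp Require Import all_boot all_order all_algebra.
From mathcomp Require Import all_classical all_reals all_analysis.
From mathcomp Require Import zify ring lra.
Import Order.TTheory GRing.Theory Num.Theory.
Import numFieldNormedType.Exports.
Local Open Scope ring_scope.

(* Reading a word from left to right, d = |w[:k]|_0 - alpha k moves by 1 - alpha
   or by - alpha and has to stay in ]-r, r], so |B_{n,alpha,r}| satisfies the
   recursion N(n+1, d) = N(n, d - alpha) + N(n, d + 1 - alpha), killed outside
   of the strip.

   Value of the limit.  With H = (1/alpha)^alpha (1/(1-alpha))^(1-alpha) and
   rho = alpha / (1 - alpha), the function rho^d satisfies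
   rho^(d - alpha) + rho^(d + 1 - alpha) = H rho^d, hence N(n, 0) = O(H^n).
   Multiplying it by max(0, r^2 - d^2) gives a subsolution with factor
   H (1 - e) once r is large, hence H (1 - e) <= e_{alpha,r} <= H.

   Existence of the growth rate for fixed r.  Relative to the level
   floor(alpha k), the admissible numbers of zeros form a fixed window of 2r
   integers, and the admissible moves at time k are governed by the k-th letter
   of the mechanical word of slope alpha.  Both letters recur with bounded gaps,
   so any two positions of the window are connected and the counts from
   different positions are comparable; a mismatch between two factors of the
   mechanical word therefore costs a bounded factor.  As every factor agrees up
   to a small density of mismatches with one starting at a bounded time, the
   logarithm of the count is subadditive up to an error e m + D_e, which is
   enough for a Fekete argument. *)

(** * Counting paths in a window driven by a binary word *)

Section WindowPaths.
Variables (r : nat) (s : nat -> bool).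

Definition in_window (i : int) : bool := (- r%:Z < i) && (i <= r%:Z).

(** Here [i] stands for the number of zeros read before time [m] minus the current level. If [s m]
    holds the level rises, so the moves are -1 and 0; otherwise they are 0 and +1. *)
Fixpoint window_paths (m n : nat) (i : int) : nat :=
  (in_window i *
   if n is n'.+1 then
     window_paths m.+1 n' (i - (s m)%:Z) + window_paths m.+1 n' (i + 1 - (s m)%:Z)
   else 1)%N.

Lemma window_paths_out m n i : ~~ in_window i -> window_paths m n i = 0%N.
Proof. by case: n => [|n] /= /negPf ->. Qed.

Lemma window_pathsS {m n i} : in_window i -> window_paths m n.+1 i =
  (window_paths m.+1 n (i - (s m)%:Z) + window_paths m.+1 n (i + 1 - (s m)%:Z))%N.
Proof. by move=> /= ->; rewrite mul1n. Qed.

Lemma window_pathsS_le m n i : (window_paths m n.+1 i <=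
  window_paths m.+1 n (i - (s m)%:Z) + window_paths m.+1 n (i + 1 - (s m)%:Z))%N.
Proof.
by case: (boolP (in_window i)) => [/window_pathsS -> | /window_paths_out ->].
Qed.

(** Whatever the letter [s m], one of the two moves leaves [i] unchanged. *)
Lemma window_paths_stay1 m n i : (window_paths m.+1 n i <= window_paths m n.+1 i)%N.
Proof.
case: (boolP (in_window i)) => [/window_pathsS -> | /window_paths_out -> //].
case: (s m); last by rewrite subr0 leq_addr.
by rewrite addrK leq_addl.
Qed.

Lemma window_paths_stay k m n i :
  (window_paths (m + k) n i <= window_paths m (n + k) i)%N.
Proof.
elim: k m n => [|k IH] m n; first by rewrite !addn0.
rewrite addnS -addSn; apply: leq_trans (IH m.+1 n) _.
by rewrite addnS; exact: window_paths_stay1.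
Qed.

Lemma window_paths_gt0 m n i : in_window i -> (0 < window_paths m n i)%N.
Proof.
move=> wi; have := window_paths_stay n m 0 i; rewrite add0n.
by apply: leq_trans; rewrite /= wi.
Qed.

Lemma window_paths_cat {m p q i B} :
  (forall i', window_paths (m + p) q i' <= B)%N ->
  (window_paths m (p + q) i <= window_paths m p i * B)%N.
Proof.
elim: p m i => [|p IH] m i leB.
  rewrite add0n; case: (boolP (in_window i)) => wi /=; last by rewrite window_paths_out.
  by rewrite wi !mul1n -[X in window_paths X](addn0 m) leB.
rewrite addSn; case: (boolP (in_window i)) => wi; last by rewrite !window_paths_out.
rewrite !window_pathsS // mulnDl.
by apply: leq_add; apply: IH => i'; rewrite addSnnS.
Qed.

Lemma window_paths_le2X m n i : (window_paths m n i <= 2 ^ n)%N.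
Proof.
elim: n m i => [|n IH] m i; first by rewrite /=; case: in_window.
by rewrite expnS mul2n -addnn (leq_trans (window_pathsS_le _ _ _)) ?leq_add.
Qed.

Lemma window_paths_extend k m n i :
  (window_paths m (n + k) i <= 2 ^ k * window_paths m n i)%N.
Proof. by rewrite mulnC; apply: window_paths_cat => i'; exact: window_paths_le2X. Qed.

(** Stay at [i] until time [m + t], whose letter [b] offers a unit move: down for [true], up for
    [false]. *)
Lemma window_paths_move (b : bool) t m n i :
  in_window i -> s (m + t)%N = b ->
  (window_paths (m + t).+1 n (i + (~~ b)%:Z - b%:Z) <= window_paths m (n + t.+1) i)%N.
Proof.
move=> wi smt; rewrite -addSnnS; apply: leq_trans (window_paths_stay t m n.+1 i).
rewrite window_pathsS // smt; case: b smt => _ /=.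
  by rewrite addr0 leq_addr.
by rewrite !subr0 leq_addl.
Qed.

Variable G : nat.
Hypothesis letter_recurs : forall (b : bool) m, exists2 t, (t < G)%N & s (m + t)%N = b.

(** Idle steps after the move pad its duration to exactly [G], uniformly in [m] and in the
    direction. *)
Lemma window_paths_step (b : bool) m n i : in_window i ->
  (window_paths (m + G) n (i + (~~ b)%:Z - b%:Z) <= window_paths m (n + G) i)%N.
Proof.
move=> wi; have [t tG st] := letter_recurs b m.
have := @window_paths_move b t m (n + (G - t.+1)) i wi st.
rewrite -addnA subnK //; apply: leq_trans.
by have := window_paths_stay (G - t.+1) (m + t).+1 n
  (i + (~~ b)%:Z - b%:Z); rewrite -addnS -addnA subnKC.
Qed.

Lemma window_paths_reach d m n i i' : in_window i -> in_window i' ->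
  (`|i' - i| <= d)%N ->
  (window_paths (m + d * G) n i' <= window_paths m (n + d * G) i)%N.
Proof.
elim: d m i => [|d IH] m i wi wi' di.
  have -> : i' = i by lia.
  by rewrite !addn0.
have [eii|nii] := eqVneq i' i; first by rewrite eii; exact: window_paths_stay.
pose b := (i' < i)%R.
pose i1 := i + (~~ b)%:Z - b%:Z.
have wi1 : in_window i1 by rewrite /i1 /b /in_window in wi wi' *; case: ltP; lia.
have di1 : (`|i' - i1| <= d)%N by rewrite /i1 /b; case: ltP; lia.
rewrite mulSn addnA; apply: leq_trans (IH _ _ wi1 wi' di1) _.
by rewrite [(G + _)%N]addnC addnA; exact: window_paths_step.
Qed.

(** Two positions differ by at most [2 * r], so [2 * r * G] steps lead from [i'] to any of them.
    Giving up the first [2 * r * G] steps of the paths from [i] costs the factor; shorter paths are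
    covered by the trivial bound. *)
Lemma window_paths_harnack m n i i' : in_window i' ->
  (window_paths m n i <= 2 ^ (2 * r * G) * window_paths m n i')%N.
Proof.
move=> wi'; set c := (2 * r * G)%N.
have [nc|cn] := ltnP n c.
  rewrite (leq_trans (window_paths_le2X _ _ _))//.
  by rewrite (leq_trans (leq_pexp2l _ (ltnW nc)))// leq_pmulr// window_paths_gt0.
rewrite -(subnKC cn).
apply: (leq_trans (@window_paths_cat m c (n - c) i (window_paths m (c + (n - c)) i') _)).
  move=> j; case: (boolP (in_window j)) => wj; last by rewrite window_paths_out.
  rewrite [(c + _)%N]addnC; apply: window_paths_reach => //.
  by rewrite /in_window in wj wi'; lia.
by rewrite leq_mul2r window_paths_le2X orbT.
Qed.

(** At a mismatch the successors of [i] may differ; each of the two is brought back to [i] by the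
    Harnack bound, whence a factor [2 * c]. Matching letters cost nothing. *)
Lemma window_paths_compare m m' n i :
  (window_paths m n i <=
   (2 * 2 ^ (2 * r * G)) ^ (\sum_(k < n) (s (m + k) != s (m' + k))) *
     window_paths m' n i)%N.
Proof.
set c := (2 ^ (2 * r * G))%N.
elim: n m m' i => [|n IH] m m' i; first by rewrite big_ord0 mul1n.
case: (boolP (in_window i)) => wi; last by rewrite !window_paths_out.
rewrite big_ord_recl !addn0.
under eq_bigr => k _ do rewrite lift0 -!addSnnS.
rewrite window_pathsS //.
have [ess|nss] := eqVneq (s m) (s m').
  by rewrite add0n (window_pathsS wi) ess mulnDr leq_add // IH.
rewrite /= expnD expn1.
set X := (_ ^ _)%N.
have key i1 : (window_paths m.+1 n i1 <= X * (c * window_paths m' n.+1 i))%N.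
  apply: leq_trans (IH m.+1 m'.+1 i1) _; rewrite leq_mul2l.
  apply/orP; right; apply: leq_trans (window_paths_harnack _ _ i1 i wi) _.
  by rewrite leq_mul2l window_paths_stay1 orbT.
apply: leq_trans (leq_add (key _) (key _)) _.
by rewrite -[leqRHS]/((2 * c * X * window_paths m' n.+1 i)%N); apply: eq_leq; ring.
Qed.

End WindowPaths.

(** * Auxiliary counting facts *)

Lemma sparse_count (p : pred nat) (K : nat) :
  (forall k l, p k -> p l -> (k < l)%N -> (k + K <= l)%N) ->
  forall n, (K * \sum_(k < n) p k <= n + K)%N.
Proof.
move=> sp; elim/ltn_ind => -[|n] IH; first by rewrite big_ord0 muln0.
case: (boolP (p n)) => pn; last first.
  rewrite big_ord_recr /= (negPf pn) addn0.
  by apply: leq_trans (IH n _) _; lia.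
have [K0|K0] := posnP K; first by rewrite K0.
(* A hit at [n] is the only one among the last [K] indices. *)
have -> : (\sum_(k < n.+1) p k = \sum_(k < n.+1 - K) p k + 1)%N.
  rewrite big_ord_recr /= pn; congr (_ + _)%N.
  rewrite -!(big_mkord xpredT (fun k => p k : nat)).
  have le : (n.+1 - K <= n)%N by lia.
  rewrite (big_cat_nat _ (n := (n.+1 - K)%N)) //= [X in (_ + X)%N]big_nat_cond.
  rewrite [X in (_ + X)%N]big1 ?addn0 // => k; rewrite andbT => /andP[k1 k2].
  apply/eqP; rewrite eqb0; apply/negP => pk.
  by have := sp _ _ pk pn k2; lia.
have [nK|Kn] := ltnP n.+1 K.
  have -> : (n.+1 - K = 0)%N by lia.
  by rewrite big_ord0; lia.
by have := IH (n.+1 - K)%N; lia.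
Qed.

Lemma finite_range_representatives N (c : nat -> 'I_N) :
  exists J, forall m, exists2 j, (j <= J)%N & c j = c m.
Proof.
have /choice[f fP] : forall a : 'I_N, exists j, forall m, c m = a -> c j = a.
  move=> a; have [[m cm]|no] := pselect (exists m, c m = a); first by exists m.
  by exists 0%N => m cm; case: no; exists m.
exists (\max_a f a)%N => m; exists (f (c m)); first exact: (leq_bigmax (c m)).
exact: fP.
Qed.

Lemma card_tupleS (n : nat) (P : pred (seq bool)) :
  #|[set w : n.+1.-tuple bool | P w]| =
  (#|[set w : n.-tuple bool | P (true :: w)]| +
   #|[set w : n.-tuple bool | P (false :: w)]|)%N.
Proof.
have inj b : injective (fun w : n.-tuple bool => [tuple of b :: w]).
  by move=> w1 w2 /(congr1 val)[] /val_inj.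
rewrite -(card_imset _ (inj true)) -(card_imset _ (inj false)) -cardsUI.
rewrite [X in (_ + #|pred_of_set X|)%N](_ : _ = finset.set0); last first.
  apply/setP => w; rewrite !inE; apply/negP => /andP[/imsetP[w1 _ ->]].
  by move=> /imsetP[w2 _ /(congr1 val)].
rewrite cards0 addn0; apply: eq_card => w; rewrite !inE.
case/tupleP: w => b w; apply/idP/orP => [Pw|].
  case: b Pw => Pw; [left|right]; apply/imsetP; exists w;
    by rewrite ?inE.
by case=> /imsetP[w1 + ->]; rewrite inE.
Qed.

(** * The strip recursion and comparison functions *)

Section Strip.
Variables (R : realType) (a : R) (r : nat).

Definition in_strip (d : R) : bool := (- r%:R < d) && (d <= r%:R).

Fixpoint strip_words (n : nat) (d : R) : nat :=
  (in_strip d *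
   if n is n'.+1 then strip_words n' (d - a) + strip_words n' (d + 1 - a)
   else 1)%N.

Lemma strip_wordsS {n d} : in_strip d ->
  strip_words n.+1 d = (strip_words n (d - a) + strip_words n (d + 1 - a))%N.
Proof. by move=> /= ->; rewrite mul1n. Qed.

Lemma strip_words_out n d : ~~ in_strip d -> strip_words n d = 0%N.
Proof. by case: n => [|n] /= /negPf ->. Qed.

(** Removing the first letter shifts the initial discrepancy [d]; the constraint at [k = 0] says
    that [d] itself lies in the strip. *)
Lemma card_strip_words n d :
  #|[set w : n.-tuple bool | [forall k : 'I_n.+1,
      in_strip (d + (zeros (take k w))%:R - a * k%:R)]]| = strip_words n d.
Proof.
elim: n d => [|n IH] d.
  rewrite /= muln1; case: (boolP (in_strip d)) => sd.
    rewrite (_ : [set w | _] = [set: 0.-tuple bool]%SET) ?cardsT ?card_tuple //.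
    apply/setP => w; rewrite !inE; apply/forallP => k.
    by rewrite (ord1 k) take0 mulr0 addr0 subr0.
  apply/eqP; rewrite cards_eq0; apply/eqP/setP => w; rewrite !inE.
  apply/negP => /forallP /(_ ord0).
  by rewrite take0 mulr0 addr0 subr0 (negPf sd).
rewrite (card_tupleS n (fun w => [forall k : 'I_n.+2,
      in_strip (d + (zeros (take k w))%:R - a * k%:R)])).
case: (boolP (in_strip d)) => sd; last first.
  rewrite strip_words_out //; apply/eqP; rewrite addn_eq0 !cards_eq0.
  by apply/andP; split; apply/eqP/setP => w; rewrite !inE;
     apply/negP => /forallP /(_ ord0); rewrite take0 mulr0 addr0 subr0 (negPf sd).
rewrite strip_wordsS // -!IH; congr (_ + _)%N; apply: eq_card => w; rewrite !inE.
- apply/forallP/forallP => h k.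
    have := h (lift ord0 k); rewrite lift0 /=.
    by congr (in_strip _); rewrite -[k.+1%:R]natr1 /zeros /=; ring.
  case: (unliftP ord0 k) => [k' ->|->].
    have := h k'; rewrite lift0 /=.
    by congr (in_strip _); rewrite -[k'.+1%:R]natr1 /zeros /=; ring.
  by rewrite take0 mulr0 addr0 subr0.
- apply/forallP/forallP => h k.
    have := h (lift ord0 k); rewrite lift0 /=.
    by congr (in_strip _); rewrite -[k.+1%:R]natr1 /zeros /= natrD; ring.
  case: (unliftP ord0 k) => [k' ->|->].
    have := h k'; rewrite lift0 /=.
    by congr (in_strip _); rewrite -[k'.+1%:R]natr1 /zeros /= natrD; ring.
  by rewrite take0 mulr0 addr0 subr0.
Qed.

Lemma card_balanced_words n : #|balanced_words n a r| = strip_words n 0.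
Proof.
rewrite -card_strip_words; apply: eq_card => w; rewrite !inE.
apply: eq_forallb => k; rewrite /in_strip add0r.
by congr (_ && _); [rewrite ltrBrDl ltrBlDr addrC | rewrite lerBlDl]; rewrite // addrC.
Qed.

Lemma strip_words_supersolution (u : R -> R) (H c : R) : 0 <= H ->
  (forall d, 0 <= u d) -> (forall d, in_strip d -> c <= u d) ->
  (forall d, in_strip d -> u (d - a) + u (d + 1 - a) <= H * u d) ->
  forall n d, c * (strip_words n d)%:R <= H ^+ n * u d.
Proof.
move=> H0 u0 cu uH; elim=> [|n IH] d.
  rewrite /= muln1 expr0 mul1r; case: (boolP (in_strip d)) => sd; last by rewrite mulr0.
  by rewrite mulr1 cu.
case: (boolP (in_strip d)) => sd; last first.
  by rewrite strip_words_out // mulr0 mulr_ge0 // exprn_ge0.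
rewrite strip_wordsS // natrD mulrDr.
apply: le_trans (lerD (IH _) (IH _)) _.
by rewrite -mulrDr exprSr -mulrA ler_wpM2l ?exprn_ge0 ?uH.
Qed.

Lemma strip_words_subsolution (v : R -> R) (H C : R) : 0 <= H -> 0 <= C ->
  (forall d, ~~ in_strip d -> v d <= 0) -> (forall d, in_strip d -> v d <= C) ->
  (forall d, in_strip d -> H * v d <= v (d - a) + v (d + 1 - a)) ->
  forall n d, H ^+ n * v d <= C * (strip_words n d)%:R.
Proof.
move=> H0 C0 v0 vC vH; elim=> [|n IH] d.
  rewrite /= muln1 expr0 mul1r; case: (boolP (in_strip d)) => sd; last by rewrite mulr0 v0.
  by rewrite mulr1 vC.
case: (boolP (in_strip d)) => sd; last first.
  by rewrite strip_words_out // mulr0 mulr_ge0_le0 // ?exprn_ge0 ?v0.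
rewrite strip_wordsS // natrD mulrDr.
apply: le_trans (lerD (IH _) (IH _)).
by rewrite -mulrDr exprSr -mulrA ler_wpM2l ?exprn_ge0 ?vH.
Qed.

End Strip.

(** * The mechanical word of slope [a] and its near-recurrence *)

Section MechanicalWord.
Variables (R : realType) (a : R).
Hypotheses (a_gt0 : 0 < a) (a_lt1 : a < 1).

Definition level (k : nat) : int := Num.floor (a * k%:R).
Definition slope_word (k : nat) : bool := level k.+1 != level k.
(** The fractional part of [a * k]: the orbit of 0 under rotation by [a]. *)
Definition phase (k : nat) : R := a * k%:R - (level k)%:~R.

Lemma phase_ge0 k : 0 <= phase k.
Proof. by rewrite subr_ge0 ge_floor. Qed.

Lemma phase_lt1 k : phase k < 1.
Proof. by rewrite ltrBlDl -intrD1 floorD1_gt. Qed.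

Lemma levelS k : level k.+1 = level k + (slope_word k)%:Z.
Proof.
rewrite /slope_word; have a0 := a_gt0; have a1 := a_lt1.
have h1 := phase_ge0 k; have h2 := phase_lt1 k.
have h3 := phase_ge0 k.+1; have h4 := phase_lt1 k.+1.
rewrite /phase -natr1 in h1 h2 h3 h4.
have : (level k)%:~R - 1 < (level k.+1)%:~R :> R by lra.
have : (level k.+1)%:~R < (level k)%:~R + 2 :> R by lra.
rewrite -[1]/(1%:~R) -[2]/(2%:~R) -intrB -intrD !ltr_int.
by case: eqVneq => /=; lia.
Qed.

Lemma phaseS k : phase k.+1 = phase k + a - (slope_word k)%:R.
Proof. by rewrite /phase levelS intrD -natr1 -pmulrn; ring. Qed.

(** The discrepancy equals [i] minus a phase in [0, 1). As the strip is open below and closed above,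
    membership then depends on the integer [i] alone. *)
Lemma strip_window_paths r m n (i : int) :
  strip_words R a r n ((level m)%:~R + i%:~R - a * m%:R) =
  window_paths r slope_word m n i.
Proof.
have in_win j k : in_strip R r ((level j)%:~R + k%:~R - a * j%:R) = in_window r k.
  have h1 := phase_ge0 j; have h2 := phase_lt1 j.
  rewrite (_ : _ - _ = k%:~R - phase j); last by rewrite /phase; ring.
  rewrite /in_strip /in_window; congr (_ && _).
    have [rk|kr] := ltP (- r%:Z) k.
      have : (- r%:Z + 1)%:~R <= k%:~R :> R by rewrite ler_int; lia.
      by rewrite intrD intrN -pmulrn => h; apply/idP; lra.
    have : k%:~R <= (- r%:Z)%:~R :> R by rewrite ler_int.
    by rewrite intrN -pmulrn => h; apply/negbTE; rewrite -leNgt; lra.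
  have [kr|rk] := leP k r%:Z.
    have : k%:~R <= (r%:Z)%:~R :> R by rewrite ler_int.
    by rewrite -pmulrn => h; apply/idP; lra.
  have : (r%:Z + 1)%:~R <= k%:~R :> R by rewrite ler_int; lia.
  by rewrite intrD -pmulrn => h; apply/negbTE; rewrite -ltNge; lra.
elim: n m i => [|n IH] m i; first by rewrite /= in_win.
rewrite /= in_win -!IH; congr (_ * (_ + _))%N; congr (strip_words _ _ _ _ _);
  by rewrite levelS -natr1 !(intrD, intrN); ring.
Qed.

Lemma level_add_const (b : bool) m n :
  (forall t, (t < n)%N -> slope_word (m + t) = b) ->
  level (m + n) = level m + (b * n)%:Z.
Proof.
elim: n => [|n IH] h; first by rewrite addn0 muln0 addr0.
rewrite addnS levelS IH => [|t tn]; last by apply: h; exact: ltnW.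
by rewrite h // mulnS; lia.
Qed.

(** If one letter is missing from [G] consecutive places, the level rises by 0 or by [G], forcing
    [a * G < 1] or [(1 - a) * G < 1]; both fail once [a * (1 - a) * G > 1]. *)
Lemma slope_word_recurs :
  exists G, forall (b : bool) m, exists2 t, (t < G)%N & slope_word (m + t) = b.
Proof.
pose x := (a * (1 - a))^-1.
have p0 : 0 < a * (1 - a) by rewrite mulr_gt0 // subr_gt0.
exists (Num.truncn x).+1 => b m; set G := _.+1.
have xG : x < G%:R by exact: truncnS_gt.
have G1 : 1 < a * (1 - a) * G%:R by rewrite -ltr_pdivrMl // mulr1.
apply: contrapT => no.
have e : level (m + G) = level m + (~~ b * G)%:Z.
  apply: level_add_const => t tG.
  have [//|ns] := eqVneq (slope_word (m + t)) (~~ b).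
  case: no; exists t => //; move: ns.
  by case: (slope_word (m + t)); case: (b).
have h1 := phase_ge0 m; have h2 := phase_lt1 m.
have h3 := phase_ge0 (m + G); have h4 := phase_lt1 (m + G).
rewrite /phase e natrD intrD -pmulrn natrM in h1 h2 h3 h4.
have G0 : 0 <= G%:R :> R by [].
have a0 := a_gt0; have a1 := a_lt1.
by case: b e no h3 h4 => /= _ _; nra.
Qed.

Lemma phase_diff m j k :
  exists z : int, phase (m + k) - phase (j + k) = phase m - phase j + z%:~R.
Proof.
exists (level m - level j - level (m + k) + level (j + k)).
by rewrite /phase !natrD !(intrD, intrN); ring.
Qed.

Lemma slope_word_mismatch m j k : slope_word (m + k) != slope_word (j + k) ->
  phase (m + k) - phase (j + k) != phase m - phase j \/
  phase (m + k.+1) - phase (j + k.+1) != phase m - phase j.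
Proof.
move=> ss; case: eqVneq => [e|]; last by left.
right; rewrite !addnS !phaseS; apply/eqP => e'.
have : (slope_word (m + k))%:R = (slope_word (j + k))%:R :> R by lra.
by move=> /eqP; rewrite eqr_nat; move: ss; do 2 case: slope_word.
Qed.

(** The offset changes by a nonzero integer, necessarily 1 or -1, so the orbit that started ahead
    has just wrapped past an integer. Which orbit this is depends only on the initial phases. *)
Lemma phase_offset_hit d m j k : `|phase m - phase j| < d ->
  phase (m + k) - phase (j + k) != phase m - phase j ->
  if phase j <= phase m then phase (m + k) < d else phase (j + k) < d.
Proof.
move=> close; have [z e] := phase_diff m j k; rewrite e.
rewrite -subr_eq0 addrAC subrr add0r intr_eq0 => z0.
have h1 := phase_ge0 (m + k); have h2 := phase_lt1 (m + k).
have h3 := phase_ge0 (j + k); have h4 := phase_lt1 (j + k).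
have h5 := phase_ge0 m; have h6 := phase_lt1 m.
have h7 := phase_ge0 j; have h8 := phase_lt1 j.
have : (1 <= z) || (z <= -1) by lia.
rewrite -!(ler_int R) intrN => hz.
move: close; rewrite ltr_norml => /andP[c1 c2].
by case: ifP => [jm|/negbT]; [|rewrite -ltNge => mj]; case/orP: hz => hz; lra.
Qed.

Lemma multiples_away_from_int K :
  (forall k, (0 < k)%N -> forall z : int, a * k%:R != z%:~R) ->
  exists2 d : R, 0 < d & forall k, (0 < k <= K)%N -> forall z : int,
    d <= `|a * k%:R - z%:~R|.
Proof.
move=> irr; elim: K => [|K [d d0 dK]]; first by exists 1 => // k; case: k.
pose d' := Num.min (phase K.+1) (1 - phase K.+1).
have ph0 : 0 < phase K.+1.
  by rewrite lt_neqAle phase_ge0 andbT eq_sym subr_eq0 irr.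
exists (Num.min d d'); first by rewrite !lt_min d0 ph0 subr_gt0 phase_lt1.
move=> k /andP[k0]; rewrite leq_eqVlt => /orP[/eqP -> z|kK z]; last first.
  by rewrite ge_min dK ?k0.
rewrite ge_min; apply/orP; right; rewrite /d' ge_min.
have [lz|zl] := leP z (level K.+1).
  apply/orP; left; rewrite /phase; apply: le_trans (ler_norm _).
  by rewrite lerB // ler_int.
apply/orP; right; rewrite distrC; apply: le_trans (ler_norm _).
have : (level K.+1 + 1)%:~R <= z%:~R :> R by rewrite ler_int; lia.
by rewrite intrD /phase; lra.
Qed.

Lemma phase_close_representatives d : 0 < d ->
  exists J, forall m, exists2 j, (j <= J)%N & `|phase m - phase j| < d.
Proof.
move=> d0; pose N := (Num.truncn d^-1).+1.
have dN : 1 < d * N%:R by rewrite -ltr_pdivrMl // mulr1 truncnS_gt.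
have N0 : 0 < N%:R :> R by rewrite ltr0n.
have cN k : (Num.truncn (phase k * N%:R) < N)%N.
  by rewrite truncn_lt_nat ?gtr_pMl ?phase_lt1 ?mulr_ge0 ?phase_ge0.
have [J hJ] := finite_range_representatives N (fun k => Ordinal (cN k)).
exists J => m; have [j jJ [e]] := hJ m; exists j => //.
have hm := @truncn_itv R (phase m * N%:R); have hj := @truncn_itv R (phase j * N%:R).
move: hm hj; rewrite !mulr_ge0 ?phase_ge0 // => /(_ isT) /andP[m1 m2] /(_ isT) /andP[j1 j2].
rewrite e -natr1 in j1 j2; rewrite -natr1 in m2.
rewrite -(ltr_pM2r N0) -(gtr0_norm N0) -normrM mulrBl (gtr0_norm N0) ltr_norml.
by apply/andP; split; lra.
Qed.

(* If the initial phases are at distance less than d, their offset can only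
   change while one of the two orbits is within d of an integer, and for
   irrational slope and small d such times are more than K apart.  For rational
   slope the word is periodic. *)
Lemma slope_word_mismatch_density (e : R) : 0 < e ->
  exists J b, forall m, exists2 j, (j <= J)%N & forall n,
    (\sum_(k < n) (slope_word (m + k) != slope_word (j + k)))%:R <= e * n%:R + b.
Proof.
move=> e0.
have [[q q0 [z qz]]|irr] := pselect (exists2 q, (0 < q)%N &
    exists z : int, a * q%:R = z%:~R).
  exists q, 0 => m; exists (m %% q)%N; first by rewrite ltnW // ltn_mod.
  move=> n; rewrite big1 ?addr0 ?mulr_ge0 ?(ltW e0) // => k _.
  apply/eqP; rewrite eqb0 negbK; apply/eqP.
  have per t i : slope_word (i * q + t) = slope_word t.
    have lev l : level (i * q + l) = level l + i%:Z * z.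
      rewrite /level (_ : a * _ = a * l%:R + (i%:Z * z)%:~R).
        by rewrite floorDrz ?intr_int // intrKfloor.
      by rewrite natrD natrM intrM -qz -pmulrn; ring.
    by rewrite /slope_word -addnS !lev (inj_eq (addIr _)).
  by rewrite {1}(divn_eq m q) -addnA per.
have irr' k : (0 < k)%N -> forall z : int, a * k%:R != z%:~R.
  by move=> k0 z; apply/eqP => h; apply: irr; exists k => //; exists z.
(* Each hit below accounts for at most two mismatches, so gaps of [K] give density at most
   [2 / K <= e]. *)
pose K := (Num.truncn (2 / e)).+1.
have K0 : 0 < K%:R :> R by rewrite ltr0n.
have Ke : 2 / K%:R <= e.
  by rewrite ler_pdivrMr // mulrC -ler_pdivrMr // ltW // truncnS_gt.
have [d d0 dK] := multiples_away_from_int K irr'.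
have [J hJ] := phase_close_representatives d d0.
exists J, (e + 2) => m; have [j jJ close] := hJ m; exists j => // n.
pose hit k := phase (m + k) - phase (j + k) != phase m - phase j.
have sparse : forall k l, hit k -> hit l -> (k < l)%N -> (k + K <= l)%N.
  move=> k l hk hl kl; rewrite leqNgt; apply/negP => lK.
  (* Two such phases of one orbit would put [a * (l - k)] within [d] of an integer, with
     [l - k <= K]. *)
  have far i : phase (i + k) < d -> phase (i + l) < d -> False.
    move=> p1 p2; have g1 := phase_ge0 (i + k); have g2 := phase_ge0 (i + l).
    have := dK (l - k)%N _ (level (i + l) - level (i + k)).
    rewrite subn_gt0 kl leq_subLR ltnW // => /(_ isT).
    rewrite natrB ?(ltnW kl) // (_ : _ - _ = phase (i + l) - phase (i + k)).
      by rewrite leNgt => /negP; apply; rewrite ltr_norml; apply/andP; split; lra.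
    by rewrite /phase !natrD intrD intrN; ring.
  have := phase_offset_hit d m j l close hl.
  have := phase_offset_hit d m j k close hk.
  by case: ifP => _; exact: far.
have cnt := sparse_count hit K sparse n.+1.
(* A mismatch at [k] shows up as a hit at [k] or at [k.+1], hence the factor 2 and the longer
   range. *)
have le2 : (\sum_(k < n) (slope_word (m + k) != slope_word (j + k)) <=
            2 * \sum_(k < n.+1) hit k)%N.
  have e1 : (\sum_(k < n.+1) hit k = \sum_(k < n) hit k + hit n)%N by rewrite big_ord_recr.
  have e2 : (\sum_(k < n.+1) hit k = hit 0 + \sum_(k < n) hit k.+1)%N by rewrite big_ord_recl.
  rewrite mul2n -addnn {1}e1 e2.
  apply: (@leq_trans (\sum_(k < n) hit k + \sum_(k < n) hit k.+1)%N); last by lia.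
  rewrite -big_split /=; apply: leq_sum => k _.
  case: (boolP (_ != _)) => // /slope_word_mismatch[h|h].
    by rewrite (_ : hit k).
  by rewrite (_ : hit k.+1) // addn1.
have : (\sum_(k < n) (slope_word (m + k) != slope_word (j + k)))%:R <= 
   2 * (\sum_(k < n.+1) hit k)%:R :> R by rewrite -natrM ler_nat.
have : K%:R * (\sum_(k < n.+1) hit k)%:R <= n%:R + 1 + K%:R :> R.
  by rewrite -natrM natr1 -natrD ler_nat.
rewrite -ler_pdivlMl // => h1 h2.
apply: le_trans h2 _; apply: le_trans (ler_wpM2l _ h1) _ => //.
have -> : 2 * (K%:R^-1 * (n%:R + 1 + K%:R)) = 2 / K%:R * (n%:R + 1) + 2 :> R.
  by field; rewrite lt0r_neq0.
have n1 : 0 <= n%:R + 1 :> R by rewrite addr_ge0.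
have := ler_wpM2r n1 Ke; lra.
Qed.

End MechanicalWord.

Local Open Scope classical_set_scope.
Local Open Scope ring_scope.

(** * Fekete's lemma with a small linear error *)

Section Fekete.
Variable R : realType.

Lemma almost_subadditive_iter (u : nat -> R) (e D : R) :
  (forall n m, u (n + m)%N <= u n + u m + e * m%:R + D) ->
  forall q t k, u (t * q + k)%N <= t%:R * (u q + e * q%:R + D) + u k.
Proof.
move=> sub q t k; elim: t => [|t IH]; first by rewrite mul0n mul0r add0r.
rewrite mulSn -addnA addnC; apply: le_trans (sub _ _) _.
by rewrite -natr1; nra.
Qed.

(** The limit is [inf A], the lower limit of [v]. A plain infimum of [v] would not do: the block
    length [q] must also be large, to make [D / q] small. *)
Lemma almost_subadditive_cvg (u : nat -> R) :
  (forall n, 0 <= u n) ->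
  (forall e, 0 < e -> exists D, forall n m,
    u (n + m)%N <= u n + u m + e * m%:R + D) ->
  cvgn (fun n => u n / n%:R).
Proof.
move=> u_ge0 sub.
pose v n := u n / n%:R.
have v0 n : 0 <= v n by rewrite divr_ge0.
pose A := [set x | forall N, exists2 n, (N <= n)%N & v n <= x].
have key e : 0 < e -> exists D, forall q, (0 < q)%N ->
    \forall n \near \oo, v n <= v q + e + D / q%:R + e.
  move=> e0; have [D subD] := sub _ e0; exists D => q' q'0.
  have q'R : 0 < q'%:R :> R by rewrite ltr0n.
  pose M := \sum_(k < q') u k.
  have M0 : 0 <= M by rewrite sumr_ge0.
  have uM k : (k < q')%N -> u k <= M.
    move=> kq; rewrite /M (bigD1 (Ordinal kq)) //= lerDl sumr_ge0 //.
  pose S := `|u q' + e * q'%:R + D|.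
  (* Divide [n] by [q']: [M] bounds [u] on the remainders, and [S] the cost of replacing the number
     of blocks by [n / q']. Both are fixed, so eventually at most [e * n]. *)
  near=> n.
  have n0 : 0 < n%:R :> R by rewrite ltr0n; near: n; exact: nbhs_infty_gt.
  rewrite /v ler_pdivrMr //.
  rewrite {1}(divn_eq n q').
  apply: le_trans (almost_subadditive_iter _ _ _ subD _ _ _) _.
  have uk := uM _ (ltn_pmod n q'0).
  have hn : (n%:R : R) = (n %/ q')%:R * q'%:R + (n %% q')%:R.
    by rewrite -natrM -natrD -divn_eq.
  have hm : 0 <= ((n %% q')%:R : R) <= q'%:R.
    by rewrite ler0n ler_nat ltnW // ltn_mod.
  have big : M + S <= e * n%:R.
    rewrite mulrC -ler_pdivrMr //; near: n; exact: nbhs_infty_ger.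
  set t := (n %/ q')%:R in hn *.
  have -> : (u q' / q'%:R + e + D / q'%:R + e) * n%:R =
     (u q' + e * q'%:R + D) * (n%:R / q'%:R) + e * n%:R.
    by field; rewrite lt0r_neq0.
  have -> : n%:R / q'%:R = t + (n %% q')%:R / q'%:R :> R.
    by rewrite hn mulrDl mulfK ?lt0r_neq0.
  set x := (n %% q')%:R / q'%:R.
  have x01 : 0 <= x <= 1.
    by rewrite /x ler_pdivlMr // ler_pdivrMr // mul0r mul1r.
  have : - S <= (u q' + e * q'%:R + D) * x.
    have : `|(u q' + e * q'%:R + D) * x| <= S.
      by rewrite normrM (ger0_norm (proj1 (andP x01))) ler_piMr //; case/andP: x01.
    by rewrite ler_norml => /andP[].
  by nra.
have Ane : A !=set0.
  have [D hD] := key 1 ltr01.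
  exists (v 1%N + 1 + D / 1%:R + 1) => N.
  have [N' _ hN'] := hD 1%N isT.
  by exists (maxn N N'); [rewrite leq_maxl | apply: hN'; rewrite /= leq_maxr].
have Alb : lbound A 0.
  by move=> x /(_ 0%N)[n _]; apply: le_trans.
have hA : has_inf A by split=> //; exists 0.
apply/cvg_ex; exists (inf A); apply/cvgrPdist_le => e e0.
have lo : \forall n \near \oo, inf A - e <= v n.
  have : ~ A (inf A - e).
    move=> /(ge_inf (proj2 hA)); lra.
  move=> /existsNP[N hN]; exists N => // n /= Nn.
  rewrite leNgt; apply/negP => /ltW ve; apply: hN; by exists n.
have hi : \forall n \near \oo, v n <= inf A + e.
  have e4 : 0 < e / 4 by rewrite divr_gt0.
  have [x Ax xe] := inf_adherent e4 hA.
  have [D hD] := key _ e4.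
  have [q qb vq] := Ax (Num.truncn (`|D| / (e / 4))).+1.
  have q0 : (0 < q)%N by apply: leq_trans qb.
  have Dq : D / q%:R <= e / 4.
    rewrite ler_pdivrMr ?ltr0n // mulrC -ler_pdivrMr //.
    apply: (@le_trans _ _ (`|D| / (e / 4))); first by rewrite ler_pM2r ?invr_gt0// ler_norm.
    apply: ltW; apply: lt_le_trans (truncnS_gt _) _.
    by rewrite ler_nat.
  have := hD q q0; apply: filterS => n hn; lra.
near=> n; rewrite -/(v n) ler_distlC; apply/andP; split.
  by near: n.
by near: n.
Unshelve. all: by end_near. Qed.

End Fekete.

(** * Existence of the growth rate *)

Section GrowthRate.
Variables (R : realType) (a : R).
Hypotheses (a_gt0 : 0 < a) (a_lt1 : a < 1).

Lemma strip_words_gt0 r n : (0 < r)%N -> (0 < strip_words R a r n 0)%N.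
Proof.
move=> r0; have := strip_window_paths R a a_gt0 a_lt1 r 0 n 0.
rewrite /level mulr0 floor0 addr0 subr0 => ->.
by rewrite window_paths_gt0 // /in_window; lia.
Qed.

(** Cut at time [n]. Continuations from any position are compared with those from 0 (Harnack), then
    with those starting at a similar time [j <= J] (mismatches), then with those starting at time 0
    (a factor [2 ^ J]). *)
Lemma ln_strip_words_almost_subadditive r : (0 < r)%N ->
  forall e : R, 0 < e -> exists D, forall n m,
    ln (strip_words R a r (n + m) 0)%:R <=
    ln (strip_words R a r n 0)%:R + ln (strip_words R a r m 0)%:R + e * m%:R + D :> R.
Proof.
move=> r0 e e0.
have E n : strip_words R a r n 0 = window_paths r (slope_word R a) 0 n 0.
  have := strip_window_paths R a a_gt0 a_lt1 r 0 n 0.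
  by rewrite /level mulr0 floor0 addr0 subr0.
have w0 : in_window r 0 by rewrite /in_window; lia.
have [G hG] := slope_word_recurs R a a_gt0 a_lt1.
set c := (2 ^ (2 * r * G))%N.
have c2 : 0 < (2 * c)%:R :> R by rewrite ltr0n muln_gt0 expn_gt0.
pose L : R := ln (2 * c)%:R.
have L1 : 0 <= L by rewrite ln_ge0 // ler1n muln_gt0 expn_gt0.
(* Each mismatch costs [L] in the logarithm; this density makes the total at most [e * m] plus a
   constant. *)
have e1 : 0 < e / (L + 1) by rewrite divr_gt0 // ltr_wpDl.
have [J [b hJ]] := slope_word_mismatch_density R a a_gt0 a_lt1 _ e1.
exists (ln c%:R + `|b| * L + ln (2 ^ J)%:R) => n m.
have [j jJ hj] := hJ n.
have {}hj := hj m; set B := (\sum_(k < m) _)%N in hj.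
have bound : (window_paths r (slope_word R a) 0 (n + m) 0 <=
   window_paths r (slope_word R a) 0 n 0 *
   (c * ((2 * c) ^ B * (2 ^ J * window_paths r (slope_word R a) 0 m 0))))%N.
  apply: window_paths_cat => i'; rewrite add0n.
  apply: leq_trans (window_paths_harnack _ _ _ hG n m i' 0 w0) _.
  rewrite leq_mul2l; apply/orP; right.
  apply: leq_trans (window_paths_compare _ _ _ hG n j m 0) _.
  rewrite leq_mul2l; apply/orP; right.
  have := window_paths_stay r (slope_word R a) j 0 m 0; rewrite add0n => h.
  apply: leq_trans h _; apply: leq_trans (window_paths_extend _ _ _ _ _ _) _.
  by rewrite leq_mul2r leq_exp2l // jJ orbT.
rewrite !E.
have pos k : 0 < (window_paths r (slope_word R a) 0 k 0)%:R :> R.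
  by rewrite ltr0n window_paths_gt0.
have pc : 0 < c%:R :> R by rewrite ltr0n expn_gt0.
have pJ : 0 < (2 ^ J)%:R :> R by rewrite ltr0n expn_gt0.
have pB : 0 < (2 * c)%:R ^+ B :> R by rewrite exprn_gt0.
have := bound; rewrite -(ler_nat R) => leR.
have pR := lt_le_trans (pos _) leR.
rewrite -ler_ln ?posrE // in leR; move: leR.
rewrite !natrM natrX !lnM ?posrE ?mulr_gt0 // lnXn //.
move=> h; apply: le_trans h _; rewrite -/L -mulr_natl.
have : B%:R * L <= e * m%:R + `|b| * L.
  apply: le_trans (ler_wpM2r L1 hj) _.
  rewrite mulrDl lerD ?ler_wpM2r ?ler_norm //.
  rewrite mulrAC ler_wpM2r // mulrAC ler_pdivrMr ?ltr_wpDl //.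
  by rewrite ler_wpM2l ?lerDl // ltW.
by lra.
Qed.

Lemma ln_strip_words_cvg r : (0 < r)%N ->
  cvgn (fun n => ln (strip_words R a r n 0)%:R / n%:R : R).
Proof.
move=> r0; apply: (almost_subadditive_cvg _ (fun n => ln (strip_words R a r n 0)%:R)).
  by move=> n; rewrite ln_ge0 // ler1n strip_words_gt0.
exact: ln_strip_words_almost_subadditive.
Qed.

Lemma growth_rate_cvg r : (0 < r)%N -> exists l : R,
  (fun n => ln (strip_words R a r n 0)%:R / n%:R) @ \oo --> l /\
  growth_rate a r = expR l.
Proof.
move=> r0; have /cvg_ex[l hl] := ln_strip_words_cvg r r0; exists l; split=> //.
rewrite /growth_rate; apply/cvg_lim => //.
rewrite (_ : (fun n => _) = (fun n => expR (ln (strip_words R a r n 0)%:R / n%:R))).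
  by apply: (cvg_comp _ _ hl); exact: continuous_expR.
apply/funext => n; rewrite card_balanced_words /powR pnatr_eq0.
by rewrite gtn_eqF ?strip_words_gt0 // mulrC.
Qed.

(** * Bounds on the growth rate by exponential tilting *)

Definition entropy_base : R := (1 / a) `^ a * (1 / (1 - a)) `^ (1 - a).
Definition tilt (d : R) : R := expR (d * (ln a - ln (1 - a))).

Lemma entropy_baseE : entropy_base = expR (- a * ln a - (1 - a) * ln (1 - a)).
Proof.
have b0 : 0 < 1 - a by rewrite subr_gt0.
rewrite /entropy_base /powR !mul1r !invr_eq0 !gt_eqF // !lnV ?posrE // -expRD.
by congr expR; ring.
Qed.

(** Together with [tilt_down], this is a Doob transform: after division by [entropy_base * tilt d]
    the steps [1 - a] and [- a] get probabilities [a] and [1 - a], a centred walk. *)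
Lemma tilt_up d : tilt (d + 1 - a) = a * entropy_base * tilt d.
Proof.
have ea : expR (ln a) = a by rewrite lnK ?posrE.
by rewrite entropy_baseE /tilt -[X in _ = X * _ * _]ea -!expRD; congr expR; ring.
Qed.

Lemma tilt_down d : tilt (d - a) = (1 - a) * entropy_base * tilt d.
Proof.
have b0 : 0 < 1 - a by rewrite subr_gt0.
have eb : expR (ln (1 - a)) = 1 - a by rewrite lnK ?posrE.
by rewrite entropy_baseE /tilt -[X in _ = X * _ * _]eb -!expRD; congr expR; ring.
Qed.

Lemma tilt_bounds r d : in_strip R r d ->
  expR (- (r%:R * `|ln a - ln (1 - a)|)) <= tilt d <=
  expR (r%:R * `|ln a - ln (1 - a)|).
Proof.
move=> /andP[d1 d2]; rewrite /tilt !ler_expR -ler_norml normrM ler_wpM2r //.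
by rewrite ler_norml d2 ltW.
Qed.

Lemma entropy_base_gt0 : 0 < entropy_base.
Proof. by rewrite entropy_baseE expR_gt0. Qed.

Lemma cvg_add_const_over_nat (h k : R) :
  (fun n : nat => h + k * n%:R^-1) @ \oo --> h.
Proof.
rewrite -[X in _ --> X]addr0 -(mulr0 k) -cvg_shiftS /=.
by apply: cvgD; [exact: cvg_cst | apply: cvgM; [exact: cvg_cst | exact: cvg_harmonic]].
Qed.

(** [tilt] solves the recursion exactly and is bounded below on the strip; the constant disappears
    after division by [n]. *)
Lemma growth_rate_le r : (0 < r)%N -> growth_rate a r <= entropy_base.
Proof.
move=> r0; have [l [hl ->]] := growth_rate_cvg r r0.
rewrite entropy_baseE ler_expR; set h := (X in l <= X).
pose k := r%:R * `|ln a - ln (1 - a)|.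
have main n : ln (strip_words R a r n 0)%:R <= h * n%:R + k.
  have := strip_words_supersolution R a r tilt entropy_base (expR (- k)).
  move=> /(_ (ltW entropy_base_gt0) (fun d => ltW (expR_gt0 _))).
  move=> /(_ (fun d sd => proj1 (andP (tilt_bounds r d sd)))).
  have hsol d : in_strip R r d -> tilt (d - a) + tilt (d + 1 - a) <= entropy_base * tilt d.
    by move=> _; rewrite tilt_up tilt_down -!mulrDl subrK mul1r.
  move=> /(_ hsol n 0); rewrite /tilt mul0r expR0 mulr1 mulrC expRN.
  rewrite ler_pdivrMr ?expR_gt0 // entropy_baseE -expRM_natr -expRD.
  by move=> hle; rewrite -[leRHS]expRK ler_ln ?posrE ?expR_gt0 ?ltr0n ?strip_words_gt0.
have hk := cvg_add_const_over_nat h k; apply: (ler_cvg_to hl hk); near=> n.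
have n0 : 0 < n%:R :> R by rewrite ltr0n; near: n; exact: nbhs_infty_gt.
rewrite ler_pdivrMr // mulrDl -mulrA mulVf ?mulr1 ?gt_eqF //.
Unshelve. all: by end_near. Qed.

Definition parabolic_cap (r : nat) (d : R) : R := Num.max 0 (r%:R ^+ 2 - d ^+ 2).

Lemma parabolic_cap_ge0 r d : 0 <= parabolic_cap r d.
Proof. by rewrite /parabolic_cap le_max lexx. Qed.

Lemma parabolic_cap_ge r d : r%:R ^+ 2 - d ^+ 2 <= parabolic_cap r d.
Proof. by rewrite /parabolic_cap le_max lexx orbT. Qed.

(* Away from the boundary the mean step only costs the variance [a (1 - a)];
   near the boundary the inward step alone makes up for the loss. *)
Lemma parabolic_cap_mean e : 0 < e -> e < 1 -> exists2 r0, (0 < r0)%N &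
  forall r d, (r0 <= r)%N ->
  (1 - e) * parabolic_cap r d <= a * parabolic_cap r (d + 1 - a) + (1 - a) * parabolic_cap r (d - a).
Proof.
move=> e0 e1; have a0 := a_gt0; have a1 := a_lt1.
have b0 : 0 < 1 - a by rewrite subr_gt0.
have ab : 0 < a * (1 - a) by rewrite mulr_gt0.
(* At height [M] the gain [e * M] pays for the variance. At distance [L] from the centre the inward
   drift [2 * a * (1 - a) * L] covers a loss of [M] plus a squared step of at most 1. *)
pose M := a * (1 - a) / e; pose L := (M + 1) / (2 * (a * (1 - a))).
have M0 : 0 < M by rewrite divr_gt0.
have L0 : 0 < L by rewrite divr_gt0 ?mulr_gt0 // addr_gt0.
have eM : e * M = a * (1 - a) by rewrite /M mulrC divfK ?gt_eqF.
have eL : 2 * (a * (1 - a)) * L = M + 1 by rewrite /L mulrC divfK ?gt_eqF ?mulr_gt0.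
(* For such [r], a height below [M] forces [L ^+ 2 < d ^+ 2]. *)
exists (Num.truncn (L ^+ 2 + M)).+1 => // r d r0r.
have rL : L ^+ 2 + M < r%:R ^+ 2.
  apply: lt_le_trans (truncnS_gt _) _; apply: (@le_trans _ _ r%:R); first by rewrite ler_nat.
  by rewrite expr2 ler_peMl // ler1n (leq_trans _ r0r).
have g1 := parabolic_cap_ge0 r (d + 1 - a); have g2 := parabolic_cap_ge0 r (d - a).
have f1 := parabolic_cap_ge r (d + 1 - a); have f2 := parabolic_cap_ge r (d - a).
set u := parabolic_cap r (d + 1 - a) in g1 f1 *; set v := parabolic_cap r (d - a) in g2 f2 *.
rewrite {1}/parabolic_cap; case: (leP 0 (r%:R ^+ 2 - d ^+ 2)) => X0; last first.
  by rewrite mulr0 addr_ge0 // mulr_ge0 // ltW.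
set X := r%:R ^+ 2 - d ^+ 2 in X0 *.
have au : a * (X - 2 * d * (1 - a) - (1 - a) ^+ 2) <= a * u.
  rewrite ler_wpM2l ?(ltW a0) //; apply: le_trans f1; rewrite /X; lra.
have bv : (1 - a) * (X + 2 * d * a - a ^+ 2) <= (1 - a) * v.
  rewrite ler_wpM2l ?(ltW b0) //; apply: le_trans f2; rewrite /X; lra.
have [MX|XM] := leP M X.
  have : e * M <= e * X by rewrite ler_wpM2l // ltW.
  rewrite eM; have -> : (1 - e) * X = X - e * X by ring.
  have : a * (X - 2 * d * (1 - a) - (1 - a) ^+ 2) + (1 - a) * (X + 2 * d * a - a ^+ 2) = X - a * (1 - a) by ring.
  by lra.
apply: (@le_trans _ _ X).
  by rewrite mulrBl mul1r gerBl mulr_ge0 // ltW.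
have dL : L ^+ 2 < d ^+ 2 by rewrite /X in XM; lra.
have [d0|d0] := leP 0 d.
  have Ld : L < d by rewrite -(ltr_pXn2r (n := 2)) ?nnegrE // ltW.
  have : 2 * (a * (1 - a)) * L <= 2 * (a * (1 - a)) * d.
    by rewrite ler_wpM2l ?(ltW Ld) // mulr_ge0 // ltW.
  rewrite eL => h.
  have au0 : 0 <= a * u by rewrite mulr_ge0 // ltW.
  have : a * X <= M by apply: le_trans (ltW XM); rewrite ler_piMl // ltW.
  have : (1 - a) * a ^+ 2 <= 1 by nra.
  have : (1 - a) * (X + 2 * d * a - a ^+ 2) = X - a * X + 2 * (a * (1 - a)) * d - (1 - a) * a ^+ 2 by ring.
  by lra.
have Ld : L < - d by rewrite -(ltr_pXn2r (n := 2)) ?nnegrE ?sqrrN // ?ltW // oppr_gt0.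
have : 2 * (a * (1 - a)) * L <= 2 * (a * (1 - a)) * - d.
  by rewrite ler_wpM2l ?(ltW Ld) // mulr_ge0 // ltW.
rewrite eL => h.
have bv0 : 0 <= (1 - a) * v by rewrite mulr_ge0 // ltW.
have : (1 - a) * X <= M by apply: le_trans (ltW XM); rewrite ler_piMl // gerBl ltW.
have : a * (1 - a) ^+ 2 <= 1 by nra.
have : a * (X - 2 * d * (1 - a) - (1 - a) ^+ 2) = X - (1 - a) * X + 2 * (a * (1 - a)) * - d - a * (1 - a) ^+ 2 by ring.
by lra.
Qed.

Lemma growth_rate_ge e : 0 < e -> e < 1 ->
  \forall r \near \oo, entropy_base * (1 - e) <= growth_rate a r.
Proof.
move=> e0 e1; have [r0 r00 hr] := parabolic_cap_mean e e0 e1.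
exists r0 => // r /= r0r; have rp : (0 < r)%N by exact: leq_trans r0r.
have [l [hl ->]] := growth_rate_cvg r rp.
have H0 : 0 < entropy_base * (1 - e).
  by rewrite mulr_gt0 ?subr_gt0 // entropy_base_gt0.
rewrite -[X in X <= _]lnK ?posrE // ler_expR; set h := ln _.
have r2 : 0 < r%:R ^+ 2 :> R by rewrite exprn_gt0 // ltr0n.
pose T := expR (r%:R * `|ln a - ln (1 - a)|).
have T0 : 0 < T := expR_gt0 _.
have parabolic_cap_in d : in_strip R r d -> parabolic_cap r d <= r%:R ^+ 2.
  by move=> _; rewrite /parabolic_cap ge_max ltW // gerBl sqr_ge0.
have parabolic_cap_out d : ~~ in_strip R r d -> parabolic_cap r d = 0.
  move=> nd; apply/eqP; rewrite eq_le parabolic_cap_ge0 andbT /parabolic_cap ge_max lexx /= subr_le0.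
  rewrite -[d ^+ 2]real_normK ?num_real // ler_pXn2r ?nnegrE //.
  rewrite leNgt ltr_norml; apply: contra nd => /andP[d1 d2].
  by rewrite /in_strip d1 ltW.
pose C := T * r%:R ^+ 2.
have C0 : 0 < C by rewrite mulr_gt0.
have main n : h * n%:R + ln (r%:R ^+ 2 / C) <= ln (strip_words R a r n 0)%:R.
  have := strip_words_subsolution R a r (fun d => tilt d * parabolic_cap r d)
    (entropy_base * (1 - e)) C (ltW H0) (ltW C0).
  have v0 d : ~~ in_strip R r d -> tilt d * parabolic_cap r d <= 0.
    by move=> /parabolic_cap_out ->; rewrite mulr0.
  have vC d : in_strip R r d -> tilt d * parabolic_cap r d <= C.
    move=> sd; apply: ler_pM; rewrite ?parabolic_cap_ge0 ?parabolic_cap_in //; first exact/ltW/expR_gt0.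
    by case/andP: (tilt_bounds r d sd).
  have vH d : in_strip R r d -> entropy_base * (1 - e) * (tilt d * parabolic_cap r d) <=
      tilt (d - a) * parabolic_cap r (d - a) + tilt (d + 1 - a) * parabolic_cap r (d + 1 - a).
    move=> _; rewrite tilt_up tilt_down.
    (* By the tilting identities this is the mean inequality for the cap, multiplied by
       [entropy_base * tilt d]. *)
    have /(ler_wpM2l (ltW (mulr_gt0 entropy_base_gt0 (expR_gt0 (d * (ln a - ln (1 - a))))))) := hr r d r0r.
    by rewrite -/(tilt d); lra.
  move=> /(_ v0 vC vH n 0).
  have -> : tilt 0 * parabolic_cap r 0 = r%:R ^+ 2.
    rewrite /tilt mul0r expR0 mul1r /parabolic_cap expr0n subr0.
    by apply/max_idPr; exact: ltW.
  rewrite mulrC -ler_pdivrMl // mulrA [_^-1 * _]mulrC.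
  have p1 : 0 < r%:R ^+ 2 / C by rewrite divr_gt0.
  have pn : 0 < (entropy_base * (1 - e)) ^+ n by rewrite exprn_gt0.
  have pp := mulr_gt0 pn p1.
  move=> hle; rewrite mulr_natr -lnXn // -lnM ?posrE // ler_ln ?posrE //.
    by rewrite mulrC.
  by rewrite ltr0n strip_words_gt0.
set k := ln _ in main.
have hk := cvg_add_const_over_nat h k; apply: (ler_cvg_to hk hl); near=> n.
have n0 : 0 < n%:R :> R by rewrite ltr0n; near: n; exact: nbhs_infty_gt.
by rewrite ler_pdivlMr // mulrDl -mulrA mulVf ?mulr1 ?gt_eqF.
Unshelve. all: by end_near. Qed.

End GrowthRate.

(** * The limit as the strip widens *)

Theorem mainTheorem2 (R : realType) (alpha : R)
    (alpha_gt0 : 0 < alpha) (alpha_lt1 : alpha < 1) :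
  growth_rate alpha r @[r --> \oo] -->
    (1 / alpha) `^ alpha * (1 / (1 - alpha)) `^ (1 - alpha).
Proof.
rewrite -/(entropy_base R alpha); set H := entropy_base R alpha.
have H0 : 0 < H := entropy_base_gt0 R alpha alpha_gt0 alpha_lt1.
apply/cvgrPdist_le => e e0.
(* The second bound keeps the loss [H * d] below [e]; the first ensures [d < 1]. *)
pose d := Num.min (1 / 2) (e / H).
have d0 : 0 < d by rewrite lt_min divr_gt0 // divr_gt0.
have d1 : d < 1 by rewrite gt_min; apply/orP; left; lra.
have dH : H * d <= e by rewrite mulrC -ler_pdivlMr // ge_min lexx orbT.
near=> r.
have r0 : (0 < r)%N by near: r; exact: nbhs_infty_gt.
have up := growth_rate_le R alpha alpha_gt0 alpha_lt1 r r0.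
have lo : H * (1 - d) <= growth_rate alpha r.
  by near: r; exact: growth_rate_ge.
rewrite ger0_norm ?subr_ge0 //.
by rewrite mulrBr mulr1 in lo; lra.
Unshelve. all: by end_near. Qed.
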